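(* For any $\sigma>0$, the LCN-MP scheme $$(\mathbb{I}-\sigma\mathbb{D}_2)\,\delta_t^+\mathbf{U}^n+\mathbb{D}\big(\widehat{\mathbf{U}}^{n+\frac12}\big)\mathbf{U}^{n+\frac12}=0,\qquad n\ge 1,$$ is uniquely solvable: for every $n\ge1$ and all given $\mathbf{U}^{n-1},\mathbf{U}^n\in\mathbb{R}^N$ there is exactly one $\mathbf{U}^{n+1}\in\mathbb{R}^N$ satisfying this equation.
   Context: Constants: $a,\gamma>0$. $N$ is a positive even integer, $L=x_R-x_L>0$, $h=L/N$, $x_j=x_L+jh$ for $0\le j\le N-1$, $\mu=2\pi/L$; $\tau>0$ is the time step. Fourier differentiation matrices: $g_j(x)=\frac1N\sum_{k=-N/2}^{N/2}\frac1{c_k}e^{ik\mu(x-x_j)}$ with $c_k=1$ for $|k|\ne N/2$ and $c_{\pm N/2}=2$; $(\mathbb{D}_k)_{jl}=\frac{d^k g_l}{dx^k}(x_j)$, $0\le j,l\le N-1$. $\mathbb{I}$ is the identity matrix. ($\mathbb{D}_1$ is real antisymmetric, $\mathbb{D}_2$ is real symmetric negative semi-definite.) For a vector $\mathbf{U}$, $\mathbb{D}(\mathbf{U})=a\mathbb{D}_1+\frac{\gamma}{3}\big(\mathrm{diag}(\mathbf{U})\mathbb{D}_1+\mathbb{D}_1\mathrm{diag}(\mathbf{U})\big)$. Time notation: $\delta_t^+\mathbf{U}^n=\frac{\mathbf{U}^{n+1}-\mathbf{U}^n}{\tau}$, $\widehat{\mathbf{U}}^{n+\frac12}=\frac{3\mathbf{U}^n-\mathbf{U}^{n-1}}{2}$,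 $\mathbf{U}^{n+\frac12}=\frac{\mathbf{U}^{n+1}+\mathbf{U}^n}{2}$. *)

(* Defs.v *)
From mathcomp Require Import all_boot all_order all_algebra.
From mathcomp Require Import complex.
From mathcomp Require Import all_classical all_reals all_analysis.

Set Implicit Arguments.
Unset Strict Implicit.
Unset Printing Implicit Defensive.

Import Order.TTheory GRing.Theory Num.Theory.
Import numFieldNormedType.Exports.

Local Open Scope ring_scope.
Local Open Scope complex_scope.

Section ComplexValued.
Context {R : realType}.

Definition expi (t : R) : R[i] := cos t +i* sin t.

(* [R[i]] has no normed-module structure over [R] in the library, so functions
   of a real variable with complex values are differentiated componentwise. *)
Definition cderive1n (k : nat) (f : R -> R[i]) (x : R) : R[i] :=
  derive1n k (fun y => complex.Re (f y)) x
    +i* derive1n k (fun y => complex.Im (f y)) x.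

End ComplexValued.

Section FourierMatrices.
Context {R : realType}.
Variables (xL xR : R) (N : nat).

Definition period : R := xR - xL.
Definition mesh_size : R := period / N%:R.
Definition node (j : nat) : R := xL + j%:R * mesh_size.
Definition wave_number : R := 2 * pi / period.

Definition fourier_weight (k : int) : R :=
  if `|k|%N == N./2 then 2 else 1.

(* For even [N], [k = i - N/2] runs over [-N/2, ..., N/2] when [i <= N]. *)
Definition fourier_cardinal (j : nat) (x : R) : R[i] :=
  (N%:R^-1)%:C *
  \sum_(i < N.+1) let k := i%:Z - (N./2)%:Z in
    ((fourier_weight k)^-1)%:C * expi (k%:~R * wave_number * (x - node j)).

Definition fourier_diff_cmx (k : nat) : 'M[R[i]]_N :=
  \matrix_(j < N, l < N) cderive1n k (fourier_cardinal l) (node j).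

(* No information is lost by taking real parts:
   see [fourier_diff_mxE] below. *)
Definition fourier_diff_mx (k : nat) : 'M[R]_N :=
  map_mx (@complex.Re R) (fourier_diff_cmx k).

Lemma fourier_cardinal_real (j : nat) (x : R) :
  ~~ odd N -> complex.Im (fourier_cardinal j x) = 0.
Proof.
move=> evenN; rewrite /fourier_cardinal.
have ImZ (c : R) (z : R[i]) : complex.Im (c%:C * z) = c * complex.Im z.
  by case: z => u v /=; rewrite mul0r addr0.
rewrite ImZ; apply/eqP; rewrite mulf_eq0; apply/orP; right; apply/eqP.
set S := \sum_(_ < _) _.
set F := fun i : 'I_N.+1 => let k := i%:Z - (N./2)%:Z in
  (fourier_weight k)^-1 * sin (k%:~R * wave_number * (x - node j)).
have ImS : complex.Im S = \sum_(i < N.+1) F i.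
  rewrite /S (big_morph (@complex.Im R) (id1 := 0) (op1 := +%R)) //; last first.
    by move=> [? ?] [? ?].
  by apply: eq_bigr => i _; rewrite ImZ.
rewrite ImS.
have opp (i : 'I_N.+1) : F (rev_ord i) = - F i.
  rewrite /F /=.
  have -> : (N.+1 - i.+1)%:Z - (N./2)%:Z = - (i%:Z - (N./2)%:Z) :> int.
    rewrite subSS -subzn -1?ltnS//.
    have {1}-> : N = (N./2 + N./2)%N.
      by rewrite addnn -[LHS]odd_double_half (negbTE evenN).
    by rewrite PoszD addrAC addrK opprB.
  by rewrite /fourier_weight abszN rmorphN /= !mulNr sinN mulrN.
have sumN : \sum_(i < N.+1) F i = - \sum_(i < N.+1) F i.
  by rewrite {1}(reindex_inj rev_ord_inj) -sumrN; apply: eq_bigr => i _.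
have : (\sum_(i < N.+1) F i) *+ 2 = 0 by rewrite mulr2n {1}sumN addNr.
by move/eqP; rewrite mulrn_eq0 => /eqP.
Qed.

Lemma fourier_diff_mxE (k : nat) :
  ~~ odd N -> map_mx (real_complex R) (fourier_diff_mx k) = fourier_diff_cmx k.
Proof.
move=> evenN; apply/matrixP => j l; rewrite !mxE /cderive1n /=; congr (_ +i* _).
rewrite (_ : (fun y => _) = cst 0); last first.
  by apply/funext => y; rewrite fourier_cardinal_real.
suff -> : derive1n k (cst 0 : R -> R) = cst 0 by [].
rewrite /derive1n; elim: k => [//|k IH].
by rewrite iterS IH; apply/funext => y; rewrite derive1_cst.
Qed.

End FourierMatrices.

Section Scheme.
Context {R : realType}.

Section TimeNotation.
Variables (N : nat) (tau : R) (U : nat -> 'cV[R]_N).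

Definition fwd_diff (n : nat) : 'cV[R]_N := tau^-1 *: (U n.+1 - U n).

(* Meaningful only for [n >= 1], since [0.-1 = 0]. *)
Definition extrap_half (n : nat) : 'cV[R]_N := 2^-1 *: (3 *: U n - U n.-1).

Definition mid_half (n : nat) : 'cV[R]_N := 2^-1 *: (U n.+1 + U n).

End TimeNotation.

Variables (xL xR : R) (N : nat) (a gamma sigma tau : R).

Local Notation D := (fourier_diff_mx xL xR N).

Definition skew_mx (U : 'cV[R]_N) : 'M[R]_N :=
  a *: D 1 + (gamma / 3) *: (diag_mx U^T *m D 1 + D 1 *m diag_mx U^T).

Definition lcn_mp (U : nat -> 'cV[R]_N) (n : nat) : Prop :=
  (1%:M - sigma *: D 2) *m fwd_diff tau U n
    + skew_mx (extrap_half U n) *m mid_half U n = 0.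

End Scheme.

(* Main.v *)
Require Import Defs.
From mathcomp Require Import all_boot all_order all_algebra.
From mathcomp Require Import complex.
From mathcomp Require Import all_classical all_reals all_analysis.
From mathcomp Require Import ring.

Set Implicit Arguments.
Unset Strict Implicit.
Unset Printing Implicit Defensive.

Import Order.TTheory GRing.Theory Num.Theory.
Local Open Scope ring_scope.

(** The scheme at step n is a linear system for the new iterate V: collecting
    the terms in V, its matrix is A = tau^-1 (I - sigma D_2) + 1/2 D(W), where
    the extrapolated state W depends on the two previous iterates only.  Hence
    unique solvability for all data amounts to the invertibility of A, and this
    follows from a coercivity estimate.  D(W) is antisymmetric, because D_1 is
    and diag(W) D_1 + D_1 diag(W) is then minus its own transpose; so D(W)
    contributes nothing to the quadratic form of A ([skew_form_eq0]).  D_2 is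
    negative semi-definite, so v^T A v >= tau^-1 |v|^2 > 0 for v <> 0
    ([lcn_mp_mx_form_gt0]), and A has a trivial kernel ([form_gt0_unitmx]).

    The two properties of the differentiation matrices are read off from the
    real part of the cardinal functions, a trigonometric sum
    N^-1 sum_k c_k^-1 cos(k mu (x - x_l)).  Its first derivative at x_j is a
    combination of the sines of k mu (x_j - x_l), hence odd under exchange of
    j and l.  Its second derivative is a combination of the cosines of
    k mu (x_j - x_l) with nonpositive coefficients, and the addition formula
    cos(p - q) = cos p cos q + sin p sin q turns the quadratic form of each of
    these cosine kernels into a sum of two squares ([cos_kernel_form_ge0]). *)

(** * Quadratic forms of real matrices *)

Section QuadraticForms.
Variables (R : realFieldType) (n : nat).
Implicit Types (A S : 'M[R]_n) (v : 'cV[R]_n).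

(** The form is a 1 x 1 matrix, equal to its transpose, while transposing it
    also changes its sign. *)
Lemma skew_form_eq0 S v : S^T = - S -> (v^T *m S *m v) 0 0 = 0.
Proof.
move=> skewS; set q := v^T *m S *m v.
have qN : q^T = - q by rewrite /q !trmx_mul trmxK skewS mulNmx mulmxN mulmxA.
have /matrixP/(_ 0 0) := qN; rewrite [LHS]mxE [RHS]mxE => /eqP.
by rewrite -addr_eq0 -mulr2n mulrn_eq0 => /eqP.
Qed.

Lemma sqnorm_gt0 v : v != 0 -> 0 < (v^T *m v) 0 0.
Proof.
have sq_ge0 i : true -> 0 <= v^T 0 i * v i 0 by rewrite mxE -expr2 sqr_ge0.
move=> v_neq0; rewrite mxE lt0r sumr_ge0 // andbT.
apply: contra v_neq0 => /eqP/(psumr_eq0P sq_ge0) sq0.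
apply/eqP/matrixP => i j; have /eqP := sq0 i isT.
by rewrite !mxE ord1 mulf_eq0 orbb => /eqP.
Qed.

Lemma form_gt0_unitmx A :
  (forall v, v != 0 -> 0 < (v^T *m A *m v) 0 0) -> A \in unitmx.
Proof.
move=> Apos; rewrite unitmxE unitfE; apply/negP => /det0P[u u_neq0 uA0].
have := Apos u^T; rewrite trmx_eq0 => /(_ u_neq0).
by rewrite trmxK uA0 mul0mx mxE ltxx.
Qed.

Lemma form_sumE A v :
  (v^T *m A *m v) 0 0 = \sum_i \sum_j v i 0 * A i j * v j 0.
Proof.
rewrite mxE exchange_big /=; apply: eq_bigr => j _.
by rewrite mxE mulr_suml; apply: eq_bigr => i _; rewrite !mxE.
Qed.

End QuadraticForms.

(** * Trigonometric sums *)

Section TrigonometricSums.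
Variable R : realType.

(** By the addition formula the kernel is a sum of two rank-one kernels, built
    from the cosines and from the sines of the phases. *)
Lemma cos_kernel_form_ge0 n (p : 'I_n -> R) (v : 'I_n -> R) :
  0 <= \sum_i \sum_j v i * cos (p i - p j) * v j.
Proof.
suff -> : \sum_i \sum_j v i * cos (p i - p j) * v j =
    (\sum_i v i * cos (p i)) ^+ 2 + (\sum_i v i * sin (p i)) ^+ 2.
  by rewrite addr_ge0 // sqr_ge0.
rewrite !expr2 !big_distrl -big_split /=; apply: eq_bigr => i _.
rewrite !big_distrr -big_split /=; apply: eq_bigr => j _.
by rewrite cosB; ring.
Qed.

Variables (m : nat) (c w : 'I_m -> R) (x0 : R).

Lemma derive1_cos_sum :
  derive1 (fun x : R => \sum_i c i * cos (w i * (x - x0)) : R) =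
  (fun x => \sum_i - (c i * w i) * sin (w i * (x - x0))).
Proof.
apply/funext => x; rewrite derive1E.
pose f i : R -> R := fun y => c i * cos (w i * (y - x0)).
have df i : is_derive x 1 (f i) (- (c i * w i) * sin (w i * (x - x0))).
  rewrite /f; apply: is_derive_eq; rewrite /GRing.scale /=; ring.
have -> : (fun y => \sum_i c i * cos (w i * (y - x0))) = \sum_i f i.
  by apply/funext => y; rewrite fct_sumE.
by have := is_derive_sum df => /@derive_val ->.
Qed.

Lemma derive1_sin_sum :
  derive1 (fun x : R => \sum_i c i * sin (w i * (x - x0)) : R) =
  (fun x => \sum_i c i * w i * cos (w i * (x - x0))).
Proof.
apply/funext => x; rewrite derive1E.
pose f i : R -> R := fun y => c i * sin (w i * (y - x0)).
have df i : is_derive x 1 (f i) (c i * w i * cos (w i * (x - x0))).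
  rewrite /f; apply: is_derive_eq; rewrite /GRing.scale /=; ring.
have -> : (fun y => \sum_i c i * sin (w i * (y - x0))) = \sum_i f i.
  by apply/funext => y; rewrite fct_sumE.
by have := is_derive_sum df => /@derive_val ->.
Qed.

End TrigonometricSums.

(** * The Fourier differentiation matrices *)

Section FourierMatrices.
Variables (R : realType) (xL xR : R) (N : nat).

Let mode (i : 'I_N.+1) : int := i%:Z - (N./2)%:Z.
Let freq (i : 'I_N.+1) : R := (mode i)%:~R * wave_number xL xR.
Let coef (i : 'I_N.+1) : R := N%:R^-1 * (fourier_weight N (mode i))^-1.
Let x (j : nat) : R := node xL xR N j.

Lemma Re_fourier_cardinal (l : nat) :
  (fun y => complex.Re (fourier_cardinal xL xR N l y)) =
  (fun y => \sum_i coef i * cos (freq i * (y - x l))) :> (R -> R).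
Proof.
have ReZ (b : R) (z : R[i]) : complex.Re (b%:C%C * z) = b * complex.Re z.
  by case: z => u v /=; rewrite mul0r subr0.
apply/funext => y; rewrite /fourier_cardinal ReZ.
rewrite (big_morph (@complex.Re R) (id1 := 0) (op1 := +%R)) //; last first.
  by move=> [? ?] [? ?].
by rewrite mulr_sumr; apply: eq_bigr => i _; rewrite ReZ mulrA.
Qed.

Lemma fourier_diff_mx1E (j l : 'I_N) :
  fourier_diff_mx xL xR N 1 j l =
  \sum_i - (coef i * freq i) * sin (freq i * (x j - x l)).
Proof.
by rewrite !mxE /cderive1n /= Re_fourier_cardinal derive1_cos_sum.
Qed.

Lemma fourier_diff_mx2E (j l : 'I_N) :
  fourier_diff_mx xL xR N 2 j l =
  - \sum_i coef i * freq i ^+ 2 * cos (freq i * (x j - x l)).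
Proof.
rewrite !mxE /cderive1n /= Re_fourier_cardinal derive1_cos_sum derive1_sin_sum.
by rewrite -sumrN; apply: eq_bigr => i _; rewrite expr2 !mulNr mulrA.
Qed.

Lemma tr_fourier_diff_mx1 :
  (fourier_diff_mx xL xR N 1)^T = - fourier_diff_mx xL xR N 1.
Proof.
apply/matrixP => j l.
rewrite [LHS]mxE [RHS]mxE !fourier_diff_mx1E -sumrN.
by apply: eq_bigr => i _; rewrite -[x l - x j]opprB mulrN sinN mulrN.
Qed.

Lemma fourier_diff_mx2_form_le0 (v : 'cV[R]_N) :
  (v^T *m fourier_diff_mx xL xR N 2 *m v) 0 0 <= 0.
Proof.
rewrite form_sumE.
under eq_bigr do under eq_bigr do
  rewrite fourier_diff_mx2E mulrN mulNr mulr_sumr mulr_suml.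
under eq_bigr do rewrite sumrN exchange_big.
rewrite sumrN exchange_big oppr_le0 /=; apply: sumr_ge0 => i _.
have coef_ge0 : 0 <= coef i.
  by rewrite /coef mulr_ge0 ?invr_ge0 ?ler0n // /fourier_weight; case: ifP.
rewrite (_ : \sum_j _ = coef i * freq i ^+ 2 *
  \sum_(j < N) \sum_(l < N) v j 0 * cos (freq i * x j - freq i * x l) * v l 0).
  by rewrite mulr_ge0 ?cos_kernel_form_ge0 // mulr_ge0 ?sqr_ge0.
rewrite mulr_sumr; apply: eq_bigr => j _; rewrite mulr_sumr.
by apply: eq_bigr => l _; rewrite mulrBr; ring.
Qed.

End FourierMatrices.

(** * Coercivity and unique solvability of the scheme *)

Section Scheme.
Variables (R : realType) (xL xR : R) (N : nat) (a gamma sigma tau : R).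

Local Notation D := (fourier_diff_mx xL xR N).

Lemma tr_skew_mx (W : 'cV[R]_N) :
  (skew_mx xL xR a gamma W)^T = - skew_mx xL xR a gamma W.
Proof.
rewrite /skew_mx linearD !linearZ /= linearD /= !trmx_mul tr_diag_mx.
rewrite tr_fourier_diff_mx1 mulmxN mulNmx -opprD !scalerN -opprD.
by rewrite [D 1 *m _ + _]addrC.
Qed.

Definition lcn_mp_mx (W : 'cV[R]_N) : 'M[R]_N :=
  tau^-1 *: (1%:M - sigma *: D 2) + 2^-1 *: skew_mx xL xR a gamma W.

Lemma lcn_mp_mx_form_gt0 (W v : 'cV[R]_N) : 0 < tau -> 0 < sigma -> v != 0 ->
  0 < (v^T *m lcn_mp_mx W *m v) 0 0.
Proof.
move=> tau_gt0 sigma_gt0 v_neq0.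
have -> : (v^T *m lcn_mp_mx W *m v) 0 0 =
    tau^-1 * ((v^T *m v) 0 0 - sigma * (v^T *m D 2 *m v) 0 0)
    + 2^-1 * (v^T *m skew_mx xL xR a gamma W *m v) 0 0.
  rewrite /lcn_mp_mx mulmxDr mulmxDl -!scalemxAr -!scalemxAl.
  rewrite mulmxBr mulmxBl mulmx1 -scalemxAr -scalemxAl.
  move: (v^T *m v) (v^T *m D 2 *m v) (v^T *m skew_mx _ _ _ _ _ *m v) => p q r.
  by rewrite !mxE.
rewrite (skew_form_eq0 _ (tr_skew_mx W)) mulr0 addr0.
rewrite mulr_gt0 ?invr_gt0 // ltr_wpDr ?sqnorm_gt0 //.
by rewrite oppr_ge0 pmulr_rle0 ?fourier_diff_mx2_form_le0.
Qed.

(** The midpoint is U n plus half the increment U n.+1 - U n, so that taking the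
    increment as the unknown moves all the known data to the right-hand side. *)
Lemma lcn_mp_increment (U : nat -> 'cV[R]_N) (n : nat) :
  lcn_mp xL xR a gamma sigma tau U n <->
  lcn_mp_mx (extrap_half U n) *m (U n.+1 - U n) =
    - (skew_mx xL xR a gamma (extrap_half U n) *m U n).
Proof.
rewrite /lcn_mp /fwd_diff /lcn_mp_mx; set S := skew_mx _ _ _ _ _.
have -> : mid_half U n = U n + 2^-1 *: (U n.+1 - U n).
  by apply/matrixP => i j; rewrite !mxE; field.
rewrite mulmxDr -!scalemxAr [in X in _ <-> X]mulmxDl -!scalemxAl.
rewrite addrCA addrC.
by split => /eqP; [rewrite addr_eq0 | rewrite -addr_eq0] => /eqP.
Qed.

End Scheme.

Theorem theorem3p2 (R : realType) (xL xR : R) (N : nat) (a gamma tau sigma : R)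
    (lt_xLR : xL < xR) (N_gt0 : (0 < N)%N) (N_even : ~~ odd N)
    (a_gt0 : 0 < a) (gamma_gt0 : 0 < gamma)
    (tau_gt0 : 0 < tau) (sigma_gt0 : 0 < sigma) :
  forall (n : nat) (U : nat -> 'cV[R]_N), (1 <= n)%N ->
    exists! V : 'cV[R]_N,
      lcn_mp xL xR a gamma sigma tau [eta U with n.+1 |-> V] n.
Proof.
move=> n U n_gt0.
set W := extrap_half U n; set A := lcn_mp_mx xL xR a gamma sigma tau W.
have unitA : A \in unitmx.
  by apply: form_gt0_unitmx => v v_neq0; apply: lcn_mp_mx_form_gt0.
set b := - (skew_mx xL xR a gamma W *m U n).
have schemeE V : lcn_mp xL xR a gamma sigma tau [eta U with n.+1 |-> V] n <->
    A *m (V - U n) = b.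
  (* The extrapolation uses the indices n and n.-1 only, so that setting the
     iterate n.+1 to V leaves it unchanged. *)
  rewrite lcn_mp_increment /extrap_half /= eqxx.
  by rewrite !ltn_eqF // (leq_ltn_trans (leq_pred n)).
exists (U n + invmx A *m b); split.
  by apply/schemeE; rewrite addrC addKr mulKVmx.
by move=> V /schemeE <-; rewrite mulKmx // subrKC.
Qed.
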